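(* The following two problems can be solved in time $\mathcal{O}(n^3)$, where $n$ is the number of vertices of $G$: (i) Minimum Cost of Irrationality: given a time-inconsistent planning model $M=(G,w,s,t,p,\beta)$, compute the minimum value $W$ such that $\Pr(X_\beta\le W)>0$ and compute $\Pr(X_\beta\le W)$; (ii) Maximum Cost of Irrationality: given $M=(G,w,s,t,p,\beta)$, compute the minimum value $W$ such that $\Pr(X_\beta\le W)=1$.
   Context: A time-inconsistent planning model is a tuple $M=(G,w,s,t,p,\beta)$ where $G$ is a finite directed acyclic graph with $n$ vertices, $w:E(G)\to\mathbb{N}$ are arc costs, $s,t\in V(G)$ with $t$ reachable from $s$, and $\beta\le 1$ is the present-bias parameter. For a $v$-$t$ path $P$ with arcs $e_1,\dots,e_m$, its perceived cost is $\zeta(P)=w(e_1)+\beta\sum_{i=2}^m w(e_i)$; $\zeta(v)$ is the minimum perceived cost over all $v$-$t$ paths, and a $v$-$t$ path attaining it is a perceived path. The function $p$ assigns to each arc $uv$ a probability $p(u,v)\ge 0$ such that $\sum_{uv\in E(G)}p(u,v)=1$ for every vertex $u\ne t$ from which $t$ is reachable, and $p(u,v)>0$ only if $uv$ is the first arc of some perceived $u$-$t$ path. The agent starts at $s$ and at each vertex $u\neq t$ moves along arc $uv$ with probability $p(u,v)$, until it reaches $t$. $C_\beta$ is the random variable equal to the actual cost (sum of $w$) of the $s$-$t$ path traversed, $d(s,t)$ is the minimum cost of an $s$-$t$ path, and $X_\beta=C_\beta/d(s,t)$. *)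

(* Defs.v *)
From HB Require Import structures.
From mathcomp Require Import all_boot all_order all_algebra.
Set Implicit Arguments. Unset Strict Implicit. Unset Printing Implicit Defensive.
Import Order.TTheory GRing.Theory Num.Theory.
Local Open Scope ring_scope.

(* Machine model.  Two register files and two memories, indexed by nat:
   nat registers / nat memory (addresses, counters, integer weights) and
   real registers / real memory (elements of an ordered field R).
   Every instruction costs one time step.  There is no nat multiplication
   and no real-to-nat conversion (floor), to avoid the well-known unit-cost
   cheats. *)
Inductive instr : Type :=
| NConst (i k : nat)
| NAdd (i j k : nat)
| NSub (i j k : nat)            (* N[i] := N[j] - N[k] (truncated)   *)
| NLoad (i j : nat)
| NStore (i j : nat)
| RNat (i j : nat)
| RAdd (i j k : nat)
| RSub (i j k : nat)
| RMul (i j k : nat)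
| RDiv (i j k : nat)
| RLoad (i j : nat)
| RStore (i j : nat)
| Jmp (l : nat)
| JNlt (i j l : nat)
| JReq (i j l : nat)
| JRlt (i j l : nat)
| Halt.

Record state (R : Type) := State {
  pc : nat; nreg : nat -> nat; rreg : nat -> R;
  nmem : nat -> nat; rmem : nat -> R }.

Definition upd (T : Type) (f : nat -> T) (i : nat) (x : T) : nat -> T :=
  fun k => if k == i then x else f k.

Definition step (R : realFieldType) (P : seq instr) (st : state R) : state R :=
  let: State c nr rr nm rm := st in
  let nx := c.+1 in
  match nth Halt P c with
  | NConst i k => State nx (upd nr i k) rr nm rm
  | NAdd i j k => State nx (upd nr i (nr j + nr k)%N) rr nm rm
  | NSub i j k => State nx (upd nr i (nr j - nr k)%N) rr nm rm
  | NLoad i j => State nx (upd nr i (nm (nr j))) rr nm rm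
  | NStore i j => State nx nr rr (upd nm (nr i) (nr j)) rm
  | RNat i j => State nx nr (upd rr i (nr j)%:R) nm rm
  | RAdd i j k => State nx nr (upd rr i (rr j + rr k)) nm rm
  | RSub i j k => State nx nr (upd rr i (rr j - rr k)) nm rm
  | RMul i j k => State nx nr (upd rr i (rr j * rr k)) nm rm
  | RDiv i j k => State nx nr (upd rr i (rr j / rr k)) nm rm
  | RLoad i j => State nx nr (upd rr i (rm (nr j))) nm rm
  | RStore i j => State nx nr rr nm (upd rm (nr i) (rr j))
  | Jmp l => State l nr rr nm rm
  | JNlt i j l => State (if (nr i < nr j)%N then l else nx) nr rr nm rm
  | JReq i j l => State (if rr i == rr j then l else nx) nr rr nm rm
  | JRlt i j l => State (if rr i < rr j then l else nx) nr rr nm rm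
  | Halt => st
  end.

(* The machine has halted when the current instruction is Halt
   (in particular when pc is outside the program); halting is absorbing. *)
Definition halted (R : Type) (P : seq instr) (st : state R) : bool :=
  if nth Halt P (pc st) is Halt then true else false.

Definition exec (R : realFieldType) (P : seq instr) (k : nat) (st : state R) :=
  iter k (step P) st.

Definition enc2 (T : Type) (n : nat) (dflt : T) (f : 'I_n -> 'I_n -> T)
    (k : nat) : T :=
  match (insub (k %/ n)%N : option 'I_n), (insub (k %% n)%N : option 'I_n) with
  | Some u, Some v => f u v
  | _, _ => dflt
  end.

(* Input encoding of M = (G,w,s,t,p,beta) with V(G) = 'I_n:
   N[0] = n, N[1] = s, N[2] = t;
   NM[u*n+v] = 1 if uv is an arc, else 0;  NM[n*n + u*n+v] = w(u,v) (0 off arcs);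
   RM[u*n+v] = p(u,v) (0 off arcs);  RM[n*n] = beta.  Everything else is 0. *)
Definition init_state (R : realFieldType) (n : nat) (E : rel 'I_n)
    (w : 'I_n -> 'I_n -> nat) (s t : 'I_n) (p : 'I_n -> 'I_n -> R) (beta : R)
    : state R :=
  State 0%N (upd (upd (upd (fun _ => 0%N) 0 n) 1 (nat_of_ord s)) 2 (nat_of_ord t))
    (fun _ => 0)
    (fun k => if (k < n * n)%N then enc2 0%N (fun u v => nat_of_bool (E u v)) k
              else enc2 0%N (fun u v => if E u v then w u v else 0%N) (k - n * n))
    (fun k => if (k < n * n)%N then enc2 0 (fun u v => if E u v then p u v else 0) k
              else if k == (n * n)%N then beta else 0).

(* Time-inconsistent planning model on vertex set 'I_n.  A path from v is
   given by the sequence q of the vertices following v. *)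

Fixpoint wcost (n : nat) (w : 'I_n -> 'I_n -> nat) (v : 'I_n) (q : seq 'I_n)
    : nat :=
  match q with [::] => 0%N | x :: q' => (w v x + wcost w x q')%N end.

Definition stpath (n : nat) (E : rel 'I_n) (t v : 'I_n) (q : seq 'I_n) : bool :=
  path E v q && (last v q == t).

Definition zeta (R : realFieldType) (n : nat) (beta : R)
    (w : 'I_n -> 'I_n -> nat) (v : 'I_n) (q : seq 'I_n) : R :=
  match q with
  | [::] => 0
  | x :: q' => (w v x)%:R + beta * (wcost w x q')%:R
  end.

Definition perceived_path (R : realFieldType) (n : nat) (E : rel 'I_n)
    (w : 'I_n -> 'I_n -> nat) (t : 'I_n) (beta : R) (v : 'I_n) (q : seq 'I_n)
    : Prop :=
  stpath E t v q /\
  forall q', stpath E t v q' -> zeta beta w v q <= zeta beta w v q'.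

Definition acyclic (n : nat) (E : rel 'I_n) : Prop :=
  forall u v, E u v -> ~~ connect E v u.

Definition valid_model (R : realFieldType) (n : nat) (E : rel 'I_n)
    (w : 'I_n -> 'I_n -> nat) (s t : 'I_n) (p : 'I_n -> 'I_n -> R) (beta : R)
    : Prop :=
  [/\ acyclic E, connect E s t, beta <= 1 &
      (forall u v, 0 <= p u v)] /\ 
  [/\
      (forall u, u != t -> connect E u t -> \sum_(v | E u v) p u v = 1) &
      (forall u v, 0 < p u v ->
         E u v /\ exists q, perceived_path E w t beta u (v :: q))].

Definition is_dist (n : nat) (E : rel 'I_n) (w : 'I_n -> 'I_n -> nat)
    (s t : 'I_n) (d : nat) : Prop :=
  (exists q, stpath E t s q /\ wcost w s q = d) /\
  (forall q, stpath E t s q -> (d <= wcost w s q)%N).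

Fixpoint pathprob (R : realFieldType) (n : nat) (p : 'I_n -> 'I_n -> R)
    (v : 'I_n) (q : seq 'I_n) : R :=
  match q with [::] => 1 | x :: q' => p v x * pathprob p x q' end.

(* Pr(X_beta <= W), X_beta = C_beta / d(s,t): sum over all s-t paths the
   agent can traverse (t reached only at the end); in a DAG on n vertices
   such paths have fewer than n arcs. *)
Definition PrLe (R : realFieldType) (n : nat) (E : rel 'I_n)
    (w : 'I_n -> 'I_n -> nat) (s t : 'I_n) (p : 'I_n -> 'I_n -> R) (d : nat)
    (W : R) : R :=
  \sum_(k < n) \sum_(q : k.-tuple 'I_n | stpath E t s q && (t \notin belast s q))
     pathprob p s q * (if (wcost w s q)%:R / d%:R <= W then 1 else 0).

(* Main.v *)
Require Import Defs.
From HB Require Import structures.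
From mathcomp Require Import all_boot all_order all_algebra.
From mathcomp Require Import all_classical all_reals.
From mathcomp Require Import zify.
Set Implicit Arguments. Unset Strict Implicit. Unset Printing Implicit Defensive.
Import Order.TTheory GRing.Theory Num.Theory.
Local Open Scope ring_scope.

(** Only the arcs of positive probability matter: by acyclicity and the perception
    condition they lead from [s] to [t] only, so [Pr(X <= W)] is positive iff some
    path of such arcs has cost at most [W d(s,t)], and is [1] iff all of them do.
    Shortest, cheapest and dearest costs over the paths with fewer than [k] arcs,
    together with the probability of the cheapest cost, satisfy a Bellman recursion
    in [k]; since paths have fewer than [n] arcs, [n] rounds of relaxing all [n^2]
    pairs suffice. The recursion is written in a small structured language compiled
    to the machine, so that time and correctness are proved by loop invariants. *)

(** Rounds indexed by the number of arcs replace a topological order, so acyclicity serves to bound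
    path lengths and to show that no arc of positive probability leaves [t]. Every round writes a
    fresh row; hence a single count of finished entries describes the memory, and row 0 is the
    zeroed memory behind the input. The delicate entry is the probability, since whether a summand
    counts depends on the minimum found at the end: the program discards the accumulated mass at
    each strict improvement. To compare it with [PrLe], the indicator there is replaced by an
    arbitrary function [g] of the cost, because passing the first arc shifts [g] by the weight of
    that arc. *)

(** * A structured language and its compiler *)

Inductive test : Type := NLt (i j : nat) | RLt (i j : nat).

Inductive cmd : Type :=
| Block (l : seq instr)
| Seq (c1 c2 : cmd)
| If (b : test) (c1 c2 : cmd)
| While (b : test) (c : cmd).

Definition branch (b : test) (l : nat) : instr :=
  match b with NLt i j => JNlt i j l | RLt i j => JRlt i j l end.

Fixpoint csize (c : cmd) : nat :=
  match c with
  | Block l => size l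
  | Seq c1 c2 => csize c1 + csize c2
  | If _ c1 c2 => csize c1 + csize c2 + 2
  | While _ c => csize c + 3
  end%N.

(** Jumps are absolute, hence the address [a]. A conditional jump falls through on failure, so the
    else branch comes first, and in a loop the fall-through is the jump out. *)
Fixpoint compile (a : nat) (c : cmd) : seq instr :=
  match c with
  | Block l => l
  | Seq c1 c2 => compile a c1 ++ compile (a + csize c1)%N c2
  | If b c1 c2 =>
      branch b (a + csize c2 + 2) ::
      compile a.+1 c2 ++
      Jmp (a + csize c1 + csize c2 + 2) :: compile (a + csize c2 + 2)%N c1
  | While b c =>
      branch b (a + 2) :: Jmp (a + csize c + 3) ::
      compile (a + 2)%N c ++ [:: Jmp a]
  end%N.

Lemma size_compile a c : size (compile a c) = csize c.
Proof.
elim: c a => //= [c1 IH1 c2 IH2|b c1 IH1 c2 IH2|b c IH] a.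
- by rewrite size_cat IH1 IH2.
- by rewrite size_cat /= IH1 IH2; lia.
- by rewrite size_cat /= IH; lia.
Qed.

Definition basic (i : instr) : bool :=
  match i with
  | Jmp _ | JNlt _ _ _ | JReq _ _ _ | JRlt _ _ _ | Halt => false
  | _ => true
  end.

(** * Program logic with time bounds *)

Section Semantics.
Variable R : realFieldType.
Implicit Types (st : state R) (c : cmd).

Definition goto (a : nat) st : state R :=
  State a (nreg st) (rreg st) (nmem st) (rmem st).

(* [put] is [upd] with a test that reduces on closed register numbers. *)
Definition put (T : Type) (f : nat -> T) (i : nat) (x : T) (k : nat) : T :=
  if eqn k i then x else f k.

Definition op st (i : instr) : state R :=
  let: State c nr rr nm rm := st in
  match i with
  | NConst i k => State c (put nr i k) rr nm rm
  | NAdd i j k => State c (put nr i (nr j + nr k)%N) rr nm rm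
  | NSub i j k => State c (put nr i (nr j - nr k)%N) rr nm rm
  | NLoad i j => State c (put nr i (nm (nr j))) rr nm rm
  | NStore i j => State c nr rr (upd nm (nr i) (nr j)) rm
  | RNat i j => State c nr (put rr i (nr j)%:R) nm rm
  | RAdd i j k => State c nr (put rr i (rr j + rr k)) nm rm
  | RSub i j k => State c nr (put rr i (rr j - rr k)) nm rm
  | RMul i j k => State c nr (put rr i (rr j * rr k)) nm rm
  | RDiv i j k => State c nr (put rr i (rr j / rr k)) nm rm
  | RLoad i j => State c nr (put rr i (rm (nr j))) nm rm
  | RStore i j => State c nr rr nm (upd rm (nr i) (rr j))
  | _ => st
  end.

Definition holds (b : test) st : bool :=
  match b with
  | NLt i j => (nreg st i < nreg st j)%N
  | RLt i j => rreg st i < rreg st j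
  end.

Lemma step_basic P a i st :
  nth Halt P a = i -> basic i -> step P (goto a st) = goto a.+1 (op st i).
Proof. by move=> Pi; case: st => c nr rr nm rm; rewrite /goto /= Pi; case: i Pi. Qed.

Lemma step_branch P a b l st : nth Halt P a = branch b l ->
  step P (goto a st) = goto (if holds b st then l else a.+1) st.
Proof. by case: st => c nr rr nm rm; rewrite /goto /=; case: b => i j /= ->. Qed.

Lemma step_jmp P a l st : nth Halt P a = Jmp l -> step P (goto a st) = goto l st.
Proof. by case: st => c nr rr nm rm; rewrite /goto /= => ->. Qed.

Definition code_at (P : seq instr) (a : nat) (l : seq instr) : Prop :=
  forall i, (i < size l)%N -> nth Halt P (a + i) = nth Halt l i.

Lemma code_at_cat P a l1 l2 : code_at P a (l1 ++ l2) ->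
  code_at P a l1 /\ code_at P (a + size l1) l2.
Proof.
move=> H; split=> i lti.
  by rewrite H ?nth_cat ?lti // size_cat; lia.
by rewrite -addnA H ?nth_cat ?size_cat ?ltn_add2l // ltnNge leq_addr addKn.
Qed.

Lemma code_at_cons P a i l : code_at P a (i :: l) ->
  nth Halt P a = i /\ code_at P a.+1 l.
Proof.
move=> H; split; first by rewrite -[a in LHS]addn0 H.
by move=> j ltj; rewrite addSnnS H.
Qed.

(** Quantifying over all programs that contain the code makes the relation compositional; [k] is
    only an upper bound because the branches of a conditional differ in length. *)
Definition runs c (k : nat) st st' : Prop :=
  forall P a, code_at P a (compile a c) ->
  exists2 j, (j <= k)%N & exec P j (goto a st) = goto (a + csize c) st'.

Lemma execS P k st : exec P k.+1 st = exec P k (step P st).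
Proof. by rewrite /exec iterSr. Qed.

Lemma exec1 P st : exec P 1 st = step P st. Proof. by []. Qed.

Lemma execD P j k st : exec P (j + k) st = exec P k (exec P j st).
Proof. by rewrite /exec addnC iterD. Qed.

Lemma runs_block l st : all basic l -> runs (Block l) (size l) st (foldl op st l).
Proof.
move=> Hl P a /= HP; exists (size l) => //.
elim: l a st Hl HP => [|i l IH] a st; first by rewrite addn0.
case/andP=> bi bl /code_at_cons[Pi Pl].
by rewrite [size _]/= execS (step_basic _ Pi bi) IH // addSnnS.
Qed.

Lemma runs_seq c1 c2 k1 k2 st1 st2 st3 :
  runs c1 k1 st1 st2 -> runs c2 k2 st2 st3 -> runs (Seq c1 c2) (k1 + k2) st1 st3.
Proof.
move=> H1 H2 P a /= /code_at_cat[/H1[j1 le1 E1]]; rewrite size_compile.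
move=> /H2[j2 le2 E2]; exists (j1 + j2)%N; first exact: leq_add.
by rewrite execD E1 E2 addnA.
Qed.

Lemma runs_if b c1 c2 k1 k2 st st' :
  (if holds b st then runs c1 k1 st st' else runs c2 k2 st st') ->
  runs (If b c1 c2) (maxn k1 k2 + 2) st st'.
Proof.
move=> H P a /= /code_at_cons[Pb /code_at_cat[P2]]; rewrite size_compile.
case/code_at_cons=> Pj P1.
have eqa : ((a.+1 + csize c2).+1 = a + csize c2 + 2)%N by lia.
rewrite eqa in P1.
case Eb: (holds b st) H => H.
- have [j lej Ej] := H _ _ P1; exists j.+1; first by lia.
  rewrite execS (step_branch _ Pb) Eb Ej.
  by congr goto; lia.
- have [j lej Ej] := H _ _ P2; exists (1 + j + 1)%N; first by lia.
  rewrite !execD !exec1 (step_branch _ Pb) Eb Ej.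
  by rewrite (step_jmp _ Pj); congr goto; lia.
Qed.

Lemma runs_while_stop b c st : ~~ holds b st -> runs (While b c) 2 st st.
Proof.
move=> nb P a /= /code_at_cons[Pb /code_at_cons[Pj _]]; exists 2%N => //.
rewrite -[2%N]/(1 + 1)%N execD !exec1 (step_branch _ Pb) (negbTE nb) (step_jmp _ Pj).
by congr goto; lia.
Qed.

Lemma runs_while_next b c k k' st st' st'' : holds b st ->
  runs c k st st' -> runs (While b c) k' st' st'' ->
  runs (While b c) (k + 2 + k') st st''.
Proof.
move=> hb H1 H2 P a HP.
have [j2 le2 E2] := H2 _ _ HP; move: HP => /=.
case/code_at_cons=> Pb /code_at_cons[_ /code_at_cat[]].
rewrite size_compile -[a.+2]addn2 => /H1[j1 le1 E1] /code_at_cons[Pj _].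
exists (1 + j1 + 1 + j2)%N; first by lia.
rewrite !execD !exec1 (step_branch _ Pb) hb E1.
by rewrite (step_jmp _ Pj) E2.
Qed.

Definition wp c (k : nat) (Q : state R -> Prop) st : Prop :=
  exists2 st', runs c k st st' & Q st'.

Lemma wp_seq c1 c2 k1 k2 Q1 Q2 st : wp c1 k1 Q1 st ->
  (forall st', Q1 st' -> wp c2 k2 Q2 st') -> wp (Seq c1 c2) (k1 + k2) Q2 st.
Proof.
move=> [st1 r1 q1] /(_ _ q1)[st2 r2 q2]; exists st2 => //.
exact: runs_seq r1 r2.
Qed.

(** [Inv] itself fixes the counter and the bound. The [2] per round pays for the test and the jump
    back, the final [2] for the failing test and the jump out. *)
Lemma wp_for i j c k N (Inv : nat -> state R -> Prop) st :
  (forall m st', (m <= N)%N -> Inv m st' -> nreg st' i = m /\ nreg st' j = N) ->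
  (forall m st', (m < N)%N -> Inv m st' -> wp c k (Inv m.+1) st') ->
  Inv 0%N st -> wp (While (NLt i j) c) (N * (k + 2) + 2) (Inv N) st.
Proof.
move=> Hij Hc H0.
suff H d : forall m st', (m + d)%N = N -> Inv m st' ->
    wp (While (NLt i j) c) (d * (k + 2) + 2) (Inv N) st' by exact: H H0.
elim: d => [|d IH] m st' eqN Im.
  move: eqN Im; rewrite addn0 => -> Im; exists st' => //.
  apply: runs_while_stop; rewrite /=.
  by have [-> ->] := Hij _ _ (leqnn N) Im; rewrite ltnn.
have ltm : (m < N)%N by lia.
have [st1 r1 I1] := Hc _ _ ltm Im.
have [|st2 r2 I2] := IH m.+1 st1 _ I1; first by lia.
exists st2 => //; rewrite mulSn -addnA; apply: runs_while_next r1 r2.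
by have [/= -> ->] := Hij _ _ (ltnW ltm) Im.
Qed.

(* [den] and [cost] are junk on [While]. *)
Fixpoint loopfree c : bool :=
  match c with
  | Block l => all basic l
  | Seq c1 c2 | If _ c1 c2 => loopfree c1 && loopfree c2
  | While _ _ => false
  end.

Fixpoint den c st : state R :=
  match c with
  | Block l => foldl op st l
  | Seq c1 c2 => den c2 (den c1 st)
  | If b c1 c2 => if holds b st then den c1 st else den c2 st
  | While _ _ => st
  end.

Fixpoint cost c : nat :=
  match c with
  | Block l => size l
  | Seq c1 c2 => cost c1 + cost c2
  | If _ c1 c2 => maxn (cost c1) (cost c2) + 2
  | While _ _ => 0
  end%N.

Lemma runs_den c st : loopfree c -> runs c (cost c) st (den c st).
Proof.
elim: c st => //= [l|c1 IH1 c2 IH2|b c1 IH1 c2 IH2] st; first exact: runs_block.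
  by case/andP=> l1 l2; apply: runs_seq (IH1 _ l1) (IH2 _ l2).
case/andP=> l1 l2; apply: runs_if.
by case: (holds b st); [apply: IH1 | apply: IH2].
Qed.

Lemma wp_den c (Q : state R -> Prop) st : loopfree c -> Q (den c st) -> wp c (cost c) Q st.
Proof. by move=> lc q; exists (den c st) => //; apply: runs_den. Qed.

Fixpoint instrs c : seq instr :=
  match c with
  | Block l => l
  | Seq c1 c2 | If _ c1 c2 => instrs c1 ++ instrs c2
  | While _ c => instrs c
  end.

Definition keeps_nreg (r : nat) (i : instr) : bool :=
  match i with
  | NConst i _ | NAdd i _ _ | NSub i _ _ | NLoad i _ => ~~ eqn r i
  | _ => true
  end.

Definition keeps_rreg (r : nat) (i : instr) : bool :=
  match i with
  | RNat i _ | RAdd i _ _ | RSub i _ _ | RMul i _ _ | RDiv i _ _ | RLoad i _ =>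
      ~~ eqn r i
  | _ => true
  end.

Definition keeps_mem (i : instr) : bool :=
  match i with NStore _ _ | RStore _ _ => false | _ => true end.

(** Frame rule: an observation respected by every instruction in the text survives whichever
    branches are taken, so unchanged registers need no case analysis. *)
Lemma den_frame (T : Type) (f : state R -> T) (ok : pred instr) c st :
  (forall st' i, ok i -> f (op st' i) = f st') -> all ok (instrs c) ->
  f (den c st) = f st.
Proof.
move=> H; elim: c st => //= [l|c1 IH1 c2 IH2|b c1 IH1 c2 IH2] st.
- elim: l st => //= i l IH st /andP[oki okl].
  by rewrite IH // H.
- by rewrite all_cat => /andP[ok1 ok2]; rewrite IH2 // IH1.
- by rewrite all_cat => /andP[ok1 ok2]; case: holds; [apply: IH1 | apply: IH2].
Qed.

Lemma nreg_den c st r : all (keeps_nreg r) (instrs c) -> nreg (den c st) r = nreg st r.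
Proof.
apply: (den_frame (f := fun s => nreg s r)) => -[a nr rr nm rm] i.
by case: i => //= i *; rewrite /put ifN.
Qed.

Lemma rreg_den c st r : all (keeps_rreg r) (instrs c) -> rreg (den c st) r = rreg st r.
Proof.
apply: (den_frame (f := fun s => rreg s r)) => -[a nr rr nm rm] i.
by case: i => //= i *; rewrite /put ifN.
Qed.

Lemma nmem_den c st : all keeps_mem (instrs c) -> nmem (den c st) = nmem st.
Proof. by apply: den_frame => -[a nr rr nm rm] []. Qed.

Lemma rmem_den c st : all keeps_mem (instrs c) -> rmem (den c st) = rmem st.
Proof. by apply: den_frame => -[a nr rr nm rm] []. Qed.

Lemma wp_exec c k Q st T : (k <= T)%N -> wp c k Q st ->
  let P := compile 0 c in let fin := exec P T (goto 0 st) in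
  halted P fin /\ exists2 st', Q st' & fin = goto (csize c) st'.
Proof.
move=> leT [st' r q] P /=.
have [j lej Ej] : exists2 j, (j <= k)%N & exec P j (goto 0 st) = goto (0 + csize c) st'.
  by apply: r => i lti.
have -> : exec P T (goto 0 st) = goto (csize c) st'.
  (* The counter now stands just past the program, where [nth] returns the default [Halt]; the
     surplus steps change nothing. *)
  rewrite -(subnKC (leq_trans lej leT)) execD Ej add0n.
  elim: (T - j)%N => // d IH; rewrite execS -[RHS]IH; congr exec.
  by rewrite /goto /= nth_default // size_compile.
by split; [rewrite /halted /= nth_default // size_compile | exists st'].
Qed.

End Semantics.

(** * The table recursions and the program *)

(** Symbolic execution that leaves arithmetic and memory updates folded. *)
Ltac run := lazy beta iota zeta
  delta [den foldl op put eqn goto nreg rreg nmem rmem holds].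

(* A table entry holds a cost plus one, and [0] stands for "no path". *)
Definition relax_min (b : bool) (w x a : nat) : nat :=
  if [&& b, (0 < x)%N & (a == 0%N) || (x + w < a)%N] then (x + w)%N else a.

(** Here [0] is already neutral, so an empty accumulator needs no case of its own. *)
Definition relax_max (b : bool) (w x a : nat) : nat :=
  if b && (0 < x)%N then maxn a (x + w) else a.

(** A pair is the least cost plus one with the probability of attaining it: a strict improvement
    discards the old mass, a tie adds to it. *)
Definition relax_prob (R : realFieldType) (q : R) (w : nat) (x a : nat * R) : nat * R :=
  if (0 < q) && (0 < x.1)%N then
    if (a.1 == 0%N) || (x.1 + w < a.1)%N then ((x.1 + w)%N, x.2 * q)
    else if (x.1 + w)%N == a.1 then (a.1, a.2 + x.2 * q) else a
  else a.

(** The left fold over [iota] mirrors the inner loop of the program step by step; row 0, for paths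
    with fewer than 0 arcs, is constantly [z]. *)
Fixpoint table (T : Type) (z : T) (ini : nat -> T) (f : nat -> nat -> T -> T -> T)
    (n k u : nat) : T :=
  if k is k'.+1 then
    foldl (fun a v => f u v (table z ini f n k' v) a) (ini u) (iota 0 n)
  else z.

(* Registers: N0 = n, N1 = s, N2 = t, N3 = 0, N4 = 1, N5 = n^2; N6, N7, N8 = k, u, v;
   N9 = u n + v; N10 = start of row k, N11 = entry (k, v), N12 = entry (k+1, u);
   N13, N14, N15, R1 = accumulated distance, minimum, maximum and probability. *)
Definition prologue : cmd := Block [:: NConst 4 1].

Definition square : cmd := While (NLt 6 0) (Block [:: NAdd 5 5 0; NAdd 6 6 4]).

(** The input lies below address [2 n^2]; the table follows with three words per vertex. Row 0 is
    never written, so the first row to fill starts [3 n] words later. *)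
Definition setup : cmd := Block
  [:: NAdd 12 5 5; NAdd 10 12 3; NAdd 12 12 0; NAdd 12 12 0; NAdd 12 12 0; NConst 6 0].

Definition load_arc : cmd := Block
  [:: NLoad 16 9; NAdd 17 5 9; NLoad 17 17; RLoad 5 9;
      NLoad 18 11; NAdd 21 11 4; NLoad 19 21; NAdd 21 21 4; NLoad 20 21;
      RLoad 6 11; RMul 6 6 5; NAdd 18 18 17; NAdd 19 19 17; NAdd 20 20 17].

(** [load_arc] has already added the weight N17 to the entry in N18, so N17 < N18 tests that the
    entry is positive. *)
Definition dist_arc : cmd :=
  If (NLt 3 16) (If (NLt 17 18)
    (If (NLt 3 13)
       (If (NLt 18 13) (Block [:: NAdd 13 18 3]) (Block [::]))
       (Block [:: NAdd 13 18 3]))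
    (Block [::])) (Block [::]).

(** A tie is detected by two failing comparisons; adding R0, which holds 0, copies a register. *)
Definition prob_arc : cmd :=
  If (RLt 0 5) (If (NLt 17 19)
    (If (NLt 3 14)
       (If (NLt 19 14) (Block [:: NAdd 14 19 3; RAdd 1 6 0])
          (If (NLt 14 19) (Block [::]) (Block [:: RAdd 1 1 6])))
       (Block [:: NAdd 14 19 3; RAdd 1 6 0]))
    (Block [::])) (Block [::]).

(** With truncated subtraction, [a + (b - a)] is the maximum of [a] and [b]. *)
Definition max_arc : cmd :=
  If (RLt 0 5) (If (NLt 17 20)
    (Block [:: NSub 20 20 15; NAdd 15 15 20]) (Block [::])) (Block [::]).

Definition next_arc : cmd := Block
  [:: NAdd 8 8 4; NAdd 9 9 4; NAdd 11 11 4; NAdd 11 11 4; NAdd 11 11 4].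

Definition arc_body : cmd :=
  Seq load_arc (Seq dist_arc (Seq prob_arc (Seq max_arc next_arc))).

(* [1 - ((u - t) + (t - u))] is the indicator of [u = t]. *)
Definition vertex_start : cmd := Block
  [:: NSub 16 7 2; NSub 17 2 7; NAdd 16 16 17; NSub 13 4 16;
      NAdd 14 13 3; NAdd 15 13 3; RNat 1 13; NConst 8 0; NAdd 11 10 3].

Definition vertex_end : cmd := Block
  [:: NStore 12 13; RStore 12 1; NAdd 12 12 4; NStore 12 14; NAdd 12 12 4;
      NStore 12 15; NAdd 12 12 4; NAdd 7 7 4].

Definition vertex_body : cmd :=
  Seq vertex_start (Seq (While (NLt 8 0) arc_body) vertex_end).

Definition row_start : cmd := Block [:: NConst 9 0; NConst 7 0].

Definition row_end : cmd := Block
  [:: NAdd 10 10 0; NAdd 10 10 0; NAdd 10 10 0; NAdd 6 6 4].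

Definition row_body : cmd :=
  Seq row_start (Seq (While (NLt 7 0) vertex_body) row_end).

Definition epilogue (b : bool) : cmd := Block
  [:: NAdd 10 10 1; NAdd 10 10 1; NAdd 10 10 1; RLoad 1 10; NLoad 13 10;
      NAdd 10 10 4; NLoad 14 10; NAdd 10 10 4; NLoad 15 10;
      NSub 13 13 4; NSub 14 14 4; NSub 15 15 4;
      RNat 2 13; RNat 3 14; RNat 4 15; RDiv 0 (if b then 4%N else 3%N) 2].

Definition program (b : bool) : cmd :=
  Seq prologue (Seq square (Seq setup (Seq (While (NLt 6 0) row_body) (epilogue b)))).

Definition arc_time : nat := Eval vm_compute in cost arc_body.

Definition program_time (n : nat) : nat :=
  (1 + (n * 4 + 2 + (6 + (n * (2 + (n * (9 + (n * (arc_time + 2) + 2 + 8) + 2) + 2 + 4) + 2)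
       + 2 + 16))))%N.

(** The time is [47 n^3 + 21 n^2 + 14 n + 27]: an inner iteration takes 45 steps plus 2 for the
    loop. *)
Lemma program_time_le n : (program_time n <= 100 * n ^ 3 + 100)%N.
Proof. by rewrite /program_time /arc_time !expnS expn0 muln1; nia. Qed.

(** * Loop invariants, for arbitrary input memories *)

Section Program.
Variables (R : realFieldType) (n s t : nat) (nm0 : nat -> nat) (rm0 : nat -> R).

Definition has_arc (u v : nat) : bool := (0 < nm0 (u * n + v))%N.
Definition wt (u v : nat) : nat := nm0 (n * n + (u * n + v)).
Definition pr (u v : nat) : R := rm0 (u * n + v).

Definition dist_step u v := relax_min (has_arc u v) (wt u v).
Definition max_step u v := relax_max (0 < pr u v) (wt u v).
Definition prob_step u v := relax_prob (pr u v) (wt u v).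

(** The empty path: at [t] it costs 0, stored as 1; elsewhere there is none. *)
Definition ind (u : nat) : nat := (u == t).
Definition dist_tab := table 0%N ind dist_step n.
Definition max_tab := table 0%N ind max_step n.
Definition prob_tab :=
  table (0%N, 0) (fun u => (ind u, (ind u)%:R)) prob_step n.

Definition addr (j : nat) : nat := (2 * (n * n) + 3 * j)%N.

(** Entry [(k, u)] has index [k n + u], so one count [m] of finished entries measures the progress
    of both outer loops. *)
Definition mem_inv (m : nat) (st : state R) : Prop :=
  [/\ forall i, (i < 2 * (n * n))%N -> nmem st i = nm0 i,
      forall i, (i < n * n)%N -> rmem st i = rm0 i &
      forall j, (j < m)%N ->
        [/\ nmem st (addr j) = dist_tab (j %/ n) (j %% n),
            nmem st (addr j + 1) = (prob_tab (j %/ n) (j %% n)).1,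
            nmem st (addr j + 2) = max_tab (j %/ n) (j %% n) &
            rmem st (addr j) = (prob_tab (j %/ n) (j %% n)).2]].

Definition const_inv (st : state R) : Prop :=
  [/\ nreg st 0 = n, nreg st 1 = s, nreg st 2 = t & nreg st 3 = 0%N] /\
  [/\ nreg st 4 = 1%N, nreg st 5 = (n * n)%N & rreg st 0 = 0].

(** Row 0 counts as filled, whence [k.+1 * n] finished entries after [k] rounds. *)
Definition row_inv (k : nat) (st : state R) : Prop :=
  [/\ const_inv st, mem_inv (k.+1 * n) st &
      [/\ nreg st 6 = k, nreg st 10 = addr (k * n) & nreg st 12 = addr (k.+1 * n)]].

Definition vertex_inv (k u : nat) (st : state R) : Prop :=
  [/\ const_inv st, mem_inv (k.+1 * n + u) st &
      [/\ nreg st 6 = k, nreg st 10 = addr (k * n) & nreg st 12 = addr (k.+1 * n + u)] /\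
      nreg st 7 = u /\ nreg st 9 = (u * n)%N].

(** The inner fold stopped before vertex [v]. At [v = n] it is convertible to the entry of the next
    row, which [vertex_endP] stores. *)
Definition scan (T : Type) (f : nat -> nat -> T -> T -> T) (x : nat -> T) (a0 : T)
    (u v : nat) : T := foldl (fun a v => f u v (x v) a) a0 (iota 0 v).

Lemma scanS (T : Type) (f : nat -> nat -> T -> T -> T) x a0 u v :
  scan f x a0 u v.+1 = f u v (x v) (scan f x a0 u v).
Proof. by rewrite /scan -addn1 iotaD foldl_cat. Qed.

Definition dist_scan k u := scan dist_step (dist_tab k) (ind u) u.
Definition max_scan k u := scan max_step (max_tab k) (ind u) u.
Definition prob_scan k u :=
  scan prob_step (prob_tab k) (ind u, (ind u)%:R) u.

Definition arc_inv (k u v : nat) (st : state R) : Prop :=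
  [/\ const_inv st, mem_inv (k.+1 * n + u) st,
      [/\ nreg st 6 = k, nreg st 10 = addr (k * n) & nreg st 12 = addr (k.+1 * n + u)],
      [/\ nreg st 7 = u, nreg st 8 = v, nreg st 9 = (u * n + v)%N &
          nreg st 11 = addr (k * n + v)] &
      [/\ nreg st 13 = dist_scan k u v, nreg st 14 = (prob_scan k u v).1,
          nreg st 15 = max_scan k u v & rreg st 1 = (prob_scan k u v).2]].

Lemma dist_arcP (st : state R) x : nreg st 3 = 0%N -> nreg st 18 = (x + nreg st 17)%N ->
  nreg (den dist_arc st) 13 = relax_min (0 < nreg st 16)%N (nreg st 17) x (nreg st 13).
Proof.
case: st => c nr rr nm rm /= e3 e18; rewrite /relax_min e3 e18 lt0n.
rewrite -[X in (X < x + _)%N]add0n ltn_add2r !lt0n.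
case: (nr 16 == 0%N) => //=; case: (x == 0%N) => //=.
by case: (nr 13 == 0%N) => /=; last case: (x + nr 17 < nr 13)%N => //=; run;
  rewrite addn0.
Qed.

Lemma max_arcP (st : state R) x : rreg st 0 = 0 -> nreg st 20 = (x + nreg st 17)%N ->
  nreg (den max_arc st) 15 = relax_max (0 < rreg st 5) (nreg st 17) x (nreg st 15).
Proof.
case: st => c nr rr nm rm /= e0 e20; rewrite /relax_max e0 e20.
rewrite -[X in (X < x + _)%N]add0n ltn_add2r.
case: (0 < rr 5) => //=; case: (0 < x)%N => //=.
by run; rewrite ?e20 maxnE.
Qed.

Lemma prob_arcP (st : state R) (x : nat * R) :
  nreg st 3 = 0%N -> rreg st 0 = 0 -> nreg st 19 = (x.1 + nreg st 17)%N ->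
  rreg st 6 = x.2 * rreg st 5 ->
  let st' := den prob_arc st in (nreg st' 14, rreg st' 1) =
    relax_prob (rreg st 5) (nreg st 17) x (nreg st 14, rreg st 1).
Proof.
case: st => c nr rr nm rm /= e3 e0 e19 e6; rewrite /relax_prob /= e0 e3 e19.
rewrite -[X in (X < x.1 + _)%N]add0n ltn_add2r.
case: (0 < rr 5) => //=; case: (0 < x.1)%N => //=; rewrite lt0n.
case: (nr 14 == 0%N) => /=; last case: ltngtP => //= _.
all: by run; rewrite ?e0 ?e3 ?addn0 ?addr0 ?e19 ?e6.
Qed.

Lemma index_lt u v : (u < n)%N -> (v < n)%N -> (u * n + v < n * n)%N.
Proof. by nia. Qed.

Lemma load_arcP k u v st : (u < n)%N -> (v < n)%N -> arc_inv k u v st ->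
  let st' := den load_arc st in
  [/\ [/\ (0 < nreg st' 16)%N = has_arc u v, nreg st' 17 = wt u v & rreg st' 5 = pr u v],
      nreg st' 18 = (dist_tab k v + nreg st' 17)%N,
      nreg st' 19 = ((prob_tab k v).1 + nreg st' 17)%N,
      nreg st' 20 = (max_tab k v + nreg st' 17)%N &
      rreg st' 6 = (prob_tab k v).2 * rreg st' 5].
Proof.
case: st => c nr rr nm rm ltu ltv Ist; rewrite /load_arc; run.
case: Ist => -[[/= e0 e1 e2 e3] [/= e4 e5 re0]] [/= Mn Mr Mt] _ [/= e7 e8 e9 e11] _.
have lt2 := index_lt ltu ltv.
have n0 : (0 < n)%N by lia.
have [|T1 T2 T3 T4] := Mt (k * n + v)%N; first by rewrite mulSn; lia.
rewrite divnMDl // modnMDl divn_small // modn_small // addn0 in T1 T2 T3 T4.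
by rewrite e4 e5 e9 e11 -addnA T1 T2 T3 T4 !Mn ?Mr //; lia.
Qed.

Lemma arc_bodyP k u v st : (u < n)%N -> (v < n)%N -> arc_inv k u v st ->
  wp arc_body (cost arc_body) (arc_inv k u v.+1) st.
Proof.
move=> ltu ltv Ist; apply: wp_den => //.
have [] := load_arcP ltu ltv Ist.
case: Ist => -[[e0 e1 e2 e3] [e4 e5 re0]] [Mn Mr Mt] [e6 e10 e12] [e7 e8 e9 e11].
case=> e13 e14 e15 re1.
(* Everything but the advance of the pointers, so that one use of the frame rule covers all
   registers it leaves alone. *)
pose c4 := Seq load_arc (Seq dist_arc (Seq prob_arc max_arc)).
have -> : den arc_body st = den next_arc (den c4 st) by [].
have Ec : den c4 st = den max_arc (den prob_arc (den dist_arc (den load_arc st))) by [].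
have F i : all (keeps_nreg i) (instrs c4) -> nreg (den c4 st) i = nreg st i.
  exact: nreg_den.
have F0 : rreg (den c4 st) 0 = 0 by rewrite rreg_den.
have Fn : nmem (den c4 st) = nmem st by rewrite nmem_den.
have Fr : rmem (den c4 st) = rmem st by rewrite rmem_den.
move=> [h16 h17 h5] h18 h19 h20 h6.
have fd : nreg (den c4 st) 13 = dist_scan k u v.+1.
  rewrite /dist_scan scanS -/(dist_scan k u v) /dist_step -h16 -h17 Ec.
  rewrite (@nreg_den _ max_arc) // (@nreg_den _ prob_arc) // (dist_arcP _ h18).
    by rewrite (@nreg_den _ load_arc _ 13) // e13.
  by rewrite nreg_den.
have fx : nreg (den c4 st) 15 = max_scan k u v.+1.
  rewrite /max_scan scanS -/(max_scan k u v) /max_step -h5 -h17 Ec.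
  rewrite (@max_arcP _ (max_tab k v)).
  - rewrite (@rreg_den _ prob_arc) // (@rreg_den _ dist_arc) //.
    rewrite !(@nreg_den _ prob_arc) // !(@nreg_den _ dist_arc) //.
    by rewrite (@nreg_den _ load_arc _ 15) // e15.
  - by rewrite (@rreg_den _ prob_arc) // (@rreg_den _ dist_arc) // rreg_den.
  - by rewrite !(@nreg_den _ prob_arc) // !(@nreg_den _ dist_arc).
have fp : (nreg (den c4 st) 14, rreg (den c4 st) 1) = prob_scan k u v.+1.
  rewrite /prob_scan scanS -/(prob_scan k u v) /prob_step -h5 -h17 Ec.
  rewrite (@nreg_den _ max_arc) // (@rreg_den _ max_arc) // (@prob_arcP _ (prob_tab k v)).
  - rewrite !(@nreg_den _ dist_arc) // !(@rreg_den _ dist_arc) //.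
    rewrite (@nreg_den _ load_arc _ 14) // (@rreg_den _ load_arc _ 1) //.
    by rewrite e14 re1 -surjective_pairing.
  - by rewrite (@nreg_den _ dist_arc) // nreg_den.
  - by rewrite (@rreg_den _ dist_arc) // rreg_den.
  - by rewrite !(@nreg_den _ dist_arc).
  - by rewrite !(@rreg_den _ dist_arc).
move: F F0 Fn Fr fd fx fp; case: (den c4 st) => c nr rr nm rm /= F F0 Fn Fr fd fx fp.
rewrite /arc_inv /const_inv /mem_inv /next_arc -fp; run.
rewrite Fn Fr fd fx (F 0) // (F 1) // (F 2) // (F 3) // (F 4) // (F 5) // (F 6) //.
rewrite (F 7) // (F 8) // (F 9) // (F 10) // (F 11) // (F 12) //.
by split=> //; split=> //; rewrite ?e4 ?e8 ?e9 ?e11 /addr; lia.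
Qed.

Lemma vertex_startP k u st : (u < n)%N -> vertex_inv k u st ->
  wp vertex_start (cost vertex_start) (arc_inv k u 0) st.
Proof.
case: st => c nr rr nm rm ltu [Ic Im [[e6 e10 e12] [e7 e9]]].
apply: wp_den => //; case: Ic => -[/= e0 e1 e2 e3] [/= e4 e5 re0].
rewrite /arc_inv /const_inv /mem_inv /vertex_start; run.
have eind : (nr 4 - (nr 7 - nr 2 + (nr 2 - nr 7)))%N = ind u.
  by rewrite e4 [nr 7]e7 e2 /ind; case: eqP => ?; lia.
rewrite eind; split=> //; split=> //; rewrite /= ?e3 ?addn0 //.
Qed.

Lemma vertex_endP k u st : (u < n)%N -> arc_inv k u n st ->
  wp vertex_end (cost vertex_end) (vertex_inv k u.+1) st.
Proof.
case: st => c nr rr nm rm ltu.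
case=> -[[/= e0 e1 e2 e3] [/= e4 e5 re0]] [/= Mn Mr Mt] [/= e6 e10 e12].
case=> /= e7 e8 e9 e11 [/= e13 e14 e15 re1].
apply: wp_den => //; rewrite /vertex_inv /const_inv /mem_inv /vertex_end; run.
rewrite e4 e7 e9 e12 [(_ + u.+1)%N]addnS; split=> //; last first.
  by split; [split=> //; rewrite /addr; lia | lia].
have n0 : (0 < n)%N by lia.
have upd_ne T (f : nat -> T) i x j : j <> i -> upd f i x j = f j.
  by rewrite /upd; case: eqP.
have upd_eq T (f : nat -> T) i x : upd f i x i = x by rewrite /upd eqxx.
split=> [i lti|i lti|j].
- by rewrite !upd_ne ?Mn // /addr; lia.
- by rewrite !upd_ne ?Mr // /addr; lia.
rewrite ltnS leq_eqVlt => /predU1P[->|ltj].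
  rewrite divnMDl // modnMDl divn_small // modn_small // addn0.
  split.
  - by rewrite upd_ne 1?upd_ne ?upd_eq // /addr; lia.
  - by rewrite upd_ne ?upd_eq // /addr; lia.
  - by rewrite -addnA upd_eq.
  - by rewrite upd_eq.
have [//|T1 T2 T3 T4] := Mt j.
by split; rewrite !upd_ne // /addr; lia.
Qed.

Lemma vertex_bodyP k u st : (u < n)%N -> vertex_inv k u st ->
  wp vertex_body (9 + (n * (arc_time + 2) + 2 + 8)) (vertex_inv k u.+1) st.
Proof.
move=> ltu Ist; apply: wp_seq (vertex_startP ltu Ist) _ => st1 I1.
apply: (wp_seq (Q1 := arc_inv k u n)); last by move=> st2; apply: vertex_endP.
apply: wp_for I1 => [m st' _ [[[? _ _ _] _] _ _ [_ ? _ _] _] //|m st' ltm].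
exact: arc_bodyP.
Qed.

Lemma row_bodyP k st : (k < n)%N -> row_inv k st ->
  wp row_body (2 + (n * (9 + (n * (arc_time + 2) + 2 + 8) + 2) + 2 + 4)) (row_inv k.+1) st.
Proof.
move=> ltk Ist.
have I0 : wp row_start 2 (vertex_inv k 0) st.
  case: st Ist => c nr rr nm rm [[[e0 e1 e2 e3] [e4 e5 re0]] Im [e6 e10 e12]].
  apply: (wp_den (c := row_start)) => //.
  rewrite /vertex_inv /const_inv /mem_inv /row_start; run.
  by rewrite addn0 mul0n.
apply: wp_seq I0 _ => st1 I1.
apply: (wp_seq (Q1 := vertex_inv k n)).
  apply: wp_for I1 => [m st' _ [[[? _ _ _] _] _ [_ [? _]]] //|m st' ltm].
  exact: vertex_bodyP.
case=> c nr rr nm rm [[[/= e0 e1 e2 e3] [/= e4 e5 re0]] Im [[/= e6 e10 e12] [/= e7 e9]]].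
apply: (wp_den (c := row_end)) => //.
rewrite /row_inv /const_inv /row_end; split; run.
- by [].
- by rewrite mulSn addnC.
- by rewrite e0 e4 e6 e10 e12 /addr !mulSn; split; lia.
Qed.

Hypothesis lt_s : (s < n)%N.
Hypothesis nm0_out : forall i, (2 * (n * n) <= i)%N -> nm0 i = 0%N.
Hypothesis rm0_out : forall i, (2 * (n * n) <= i)%N -> rm0 i = 0.

Definition square_inv (m : nat) (st : state R) : Prop :=
  [/\ [/\ nreg st 0 = n, nreg st 1 = s, nreg st 2 = t, nreg st 3 = 0%N & nreg st 4 = 1%N],
      nreg st 5 = (m * n)%N, nreg st 6 = m & [/\ rreg st 0 = 0, nmem st = nm0 & rmem st = rm0]].

Lemma squareP st : square_inv 0 st -> wp square (n * 4 + 2) (square_inv n) st.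
Proof.
apply: (wp_for (k := 2)) => [m st' _ [[? _ _ _ _] _ ? _] //|m [c nr rr nm rm] ltm].
case=> -[/= e0 e1 e2 e3 e4] e5 e6 [r0 emn emr].
apply: (wp_den (c := Block _)) => //; rewrite /square_inv; run.
by rewrite e0 e4 e5 e6; split=> //; lia.
Qed.

Lemma setupP st : square_inv n st -> wp setup 6 (row_inv 0) st.
Proof.
case: st => c nr rr nm rm [[/= e0 e1 e2 e3 e4] e5 e6 [r0 /= -> ->]].
apply: (wp_den (c := setup)) => //; rewrite /row_inv /const_inv /mem_inv /setup; run.
split=> //; last by rewrite /addr e0 e3 e5; split; lia.
split=> // j; rewrite mul1n => ltj.
(* Row 0 is correct unwritten, because memory beyond the input is zero. *)
by rewrite divn_small // modn_small // !nm0_out ?rm0_out // /addr; lia.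
Qed.

Definition final_inv (b : bool) (st : state R) : Prop :=
  rreg st 0 = ((if b then max_tab n s else (prob_tab n s).1) - 1)%:R
              / (dist_tab n s - 1)%:R /\
  rreg st 1 = (prob_tab n s).2.

Lemma epilogueP b st : row_inv n st -> wp (epilogue b) 16 (final_inv b) st.
Proof.
case: st => c nr rr nm rm.
case=> -[[/= e0 e1 e2 e3] [/= e4 e5 re0]] [/= Mn Mr Mt] [/= e6 e10 e12].
apply: (wp_den (c := epilogue b)) => //; rewrite /final_inv /epilogue.
have n0 : (0 < n)%N by lia.
have [|T1 T2 T3 T4] := Mt (n * n + s)%N; first by rewrite mulSn; lia.
rewrite divnMDl // modnMDl divn_small // modn_small // addn0 in T1 T2 T3 T4.
have ea : (nr 10 + nr 1 + nr 1 + nr 1)%N = addr (n * n + s) by rewrite e1 e10 /addr; lia.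
rewrite -[2%N]/(1 + 1)%N addnA in T3.
by case: b; run; rewrite ea e4 T1 ?T2 ?T3 T4.
Qed.

Lemma programP b st :
  [/\ nreg st 0 = n, nreg st 1 = s, nreg st 2 = t & forall i, (2 < i)%N -> nreg st i = 0%N] ->
  rreg st 0 = 0 -> nmem st = nm0 -> rmem st = rm0 ->
  wp (program b) (program_time n) (final_inv b) st.
Proof.
move=> [e0 e1 e2 ez] r0 enm erm; rewrite /program /program_time.
have I0 : wp prologue 1 (square_inv 0) st.
  apply: (wp_den (c := prologue)) => //.
  case: st e0 e1 e2 ez r0 enm erm => c nr rr nm rm /= e0 e1 e2 ez r0 enm erm.
  rewrite /square_inv /prologue; run.
  by split; [split=> // | | | split=> //]; try exact: ez.
apply: wp_seq I0 _ => st1 I1.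
apply: wp_seq (squareP I1) _ => st2 I2.
apply: wp_seq (setupP I2) _ => st3 I3.
apply: wp_seq (epilogueP b).
apply: wp_for I3 => [m st' _ [[[? _ _ _] _] _ [? _ _]] //|m st' ltm].
exact: row_bodyP.
Qed.

End Program.

(** * Expectations over the random walk *)

Section Expect.
Variables (R : realFieldType) (n : nat) (E : rel 'I_n) (w : 'I_n -> 'I_n -> nat).
Variables (t : 'I_n) (p : 'I_n -> 'I_n -> R).

(** With [k = n] and a threshold indicator for [g], this is [PrLe] by conversion. *)
Definition expect (k : nat) (u : 'I_n) (g : nat -> R) : R :=
  \sum_(j < k) \sum_(q : j.-tuple 'I_n | stpath E t u q && (t \notin belast u q))
     pathprob p u q * g (wcost w u q).

Lemma sum_tuple0 (F : seq 'I_n -> R) (P : pred (seq 'I_n)) :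
  \sum_(q : 0.-tuple 'I_n | P q) F q = if P [::] then F [::] else 0.
Proof.
rewrite (eq_bigl (fun q => P [::] && (q == [tuple]))).
  by case: (P [::]) => /=; [rewrite big_pred1_eq | rewrite big_pred0].
by move=> q; rewrite tuple0 eqxx andbT.
Qed.

Lemma sum_tupleS j (F : seq 'I_n -> R) (P : pred (seq 'I_n)) :
  \sum_(q : j.+1.-tuple 'I_n | P q) F q =
  \sum_v \sum_(q : j.-tuple 'I_n | P (v :: q)) F (v :: q).
Proof.
rewrite pair_big_dep /=.
rewrite (reindex (fun x : 'I_n * j.-tuple 'I_n => [tuple of x.1 :: x.2])) //=.
exists (fun q : j.+1.-tuple 'I_n => (thead q, [tuple of behead q])) => [[v q] _|q _] /=.
  by congr pair; apply: val_inj.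
by rewrite -tuple_eta.
Qed.

Lemma expect0 u g : expect 0 u g = 0. Proof. by rewrite /expect big_ord0. Qed.

(** At [t] only the empty path counts, since a longer one has [t] in its [belast]. *)
Lemma expectS k u g : expect k.+1 u g =
  if u == t then g 0%N
  else \sum_(v | E u v) p u v * expect k v (fun c => g (w u v + c)%N).
Proof.
rewrite /expect big_ord_recl /=.
rewrite (@sum_tuple0 (fun q => pathprob p u q * g (wcost w u q))
  (fun q => stpath E t u q && (t \notin belast u q))) /stpath /= andbT mul1r.
under eq_bigr => j _ do rewrite (@sum_tupleS _ (fun q => pathprob p u q * g (wcost w u q))
  (fun q => stpath E t u q && (t \notin belast u q))) /stpath /=.
case: (eqVneq u t) => [->|ut].
  rewrite big1 ?addr0 // => j _; rewrite big1 // => v _; rewrite big_pred0 // => q.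
  by rewrite inE eqxx andbF.
rewrite add0r exchange_big /= [RHS]big_mkcond /=; apply: eq_bigr => v _.
case: ifP => Euv; last by rewrite big1 // => j _; rewrite big_pred0.
rewrite mulr_sumr; apply: eq_bigr => j _; rewrite mulr_sumr.
apply: eq_big => [q|q _]; last by rewrite mulrA.
by rewrite inE [t == u]eq_sym (negbTE ut).
Qed.

Definition supp : rel 'I_n := fun u v => 0 < p u v.

Hypothesis p_ge0 : forall u v, 0 <= p u v.
Hypothesis suppE : forall u v, supp u v -> E u v.
Hypothesis supp_t : forall v, ~~ supp t v.

Lemma supp_stpath_cons u v q : supp u v -> stpath supp t v q -> stpath supp t u (v :: q).
Proof. by rewrite /stpath /= => ->. Qed.

(** An arc of probability zero kills the weight of every path through it, so [g] matters on paths of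
    positive arcs only. *)
Lemma eq_expect k u g h :
  (forall q, stpath supp t u q -> (size q < k)%N -> g (wcost w u q) = h (wcost w u q)) ->
  expect k u g = expect k u h.
Proof.
elim: k u g h => [|k IH] u g h H; first by rewrite !expect0.
rewrite !expectS; case: eqP => [eut|_]; first by apply: (H [::]); rewrite // /stpath /= eut.
apply: eq_bigr => v Euv; have [pz|pnz] := eqVneq (p u v) 0; first by rewrite pz !mul0r.
have suv : supp u v by rewrite /supp lt0r pnz p_ge0.
congr (_ * _); apply: IH => q sq ltq; apply: (H (v :: q)) => //.
exact: supp_stpath_cons.
Qed.

Lemma expect_const0 k u : expect k u (fun=> 0) = 0.
Proof. by rewrite /expect big1 // => j _; rewrite big1 // => q _; rewrite mulr0. Qed.

Lemma expectB k u g h :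
  expect k u (fun c => g c - h c) = expect k u g - expect k u h.
Proof.
rewrite /expect -sumrB; apply: eq_bigr => j _; rewrite -sumrB.
by apply: eq_bigr => q _; rewrite mulrBr.
Qed.

Lemma expect_ge0 k u g : (forall c, 0 <= g c) -> 0 <= expect k u g.
Proof.
elim: k u g => [|k IH] u g H; first by rewrite expect0.
rewrite expectS; case: eqP => // _; apply: sumr_ge0 => v _.
by apply: mulr_ge0 => //; apply: IH.
Qed.

Lemma expect_gt0 k u g q : (forall c, 0 <= g c) ->
  stpath supp t u q -> (size q < k)%N -> 0 < g (wcost w u q) -> 0 < expect k u g.
Proof.
elim: k u g q => [|k IH] u g q g0; first by [].
rewrite expectS; case: q => [|v q] /=.
  by rewrite /stpath /= => ->.
rewrite /stpath /= -andbA => /and3P[suv pq lq] ltq gq.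
case: eqP => [eut|_]; first by move: suv; rewrite eut (negbTE (supp_t v)).
rewrite (bigD1 v) ?suppE //= ltr_wpDr //.
  by apply: sumr_ge0 => x _; apply: mulr_ge0 => //; apply: expect_ge0.
by apply: mulr_gt0 => //; apply: (IH v _ q) => //; rewrite /stpath pq.
Qed.

(** By contraposition: if [g] vanishes on all short paths of positive arcs, [eq_expect] replaces it
    by zero. *)
Lemma expect_gt0P k u g : (forall c, 0 <= g c) -> 0 < expect k u g ->
  exists q, [/\ stpath supp t u q, (size q < k)%N & 0 < g (wcost w u q)].
Proof.
move=> g0 H; apply: contrapT => nex.
suff E0 : expect k u g = expect k u (fun=> 0) by rewrite E0 expect_const0 ltxx in H.
apply: eq_expect => q sq ltq; apply/eqP; rewrite eq_le g0 andbT leNgt.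
by apply/negP => gq; apply: nex; exists q.
Qed.

Hypothesis p_sum : forall u, u != t -> connect E u t -> \sum_(v | E u v) p u v = 1.
Hypothesis supp_connect : forall u v, supp u v -> connect E v t.

(** The agent cannot get stuck: an arc of positive probability ends where [t] is still reachable, so
    unless [t] is reached the outgoing probabilities again sum to 1. *)
Lemma expect_total k u : connect E u t ->
  (forall q, stpath E t u q -> (size q < k)%N) -> expect k u (fun=> 1) = 1.
Proof.
elim: k u => [|k IH] u /connectP[q pq lq] H.
  by have := H q; rewrite /stpath pq -lq eqxx; move/(_ isT).
rewrite expectS; case: eqVneq => // ut.
rewrite -[RHS](p_sum ut); last by apply/connectP; exists q.
apply: eq_bigr => v Euv; have [pz|pnz] := eqVneq (p u v) 0; first by rewrite pz mul0r.
rewrite /= IH ?mulr1 //; first by apply: (@supp_connect u); rewrite /supp lt0r pnz p_ge0.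
move=> q' sq'; have := H (v :: q'); rewrite /stpath /= Euv; exact.
Qed.

End Expect.

(** * Path lengths in acyclic graphs, and folds of relaxations *)

Lemma acyclic_path_uniq n (E : rel 'I_n) v q : acyclic E -> path E v q -> uniq (v :: q).
Proof.
move=> acE; elim: q v => //= x q IH v /andP[Evx pq].
have := IH _ pq; rewrite /= => ->; rewrite andbT.
apply/negP => vin; move: (acE _ _ Evx) => /negP; apply.
exact: path_connect pq _ vin.
Qed.

Lemma acyclic_size n (E : rel 'I_n) v q : acyclic E -> path E v q -> (size q < n)%N.
Proof.
move=> acE /(acyclic_path_uniq acE) /card_uniqP /= <-.
by rewrite -[X in (_ <= X)%N](card_ord n) max_card.
Qed.

(** Applied to the first projection, it identifies the costs in the probability table as a table of
    minima. *)
Lemma table_morph (T T' : Type) (h : T -> T') z ini f z' ini' f' n k u :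
  h z = z' -> (forall v, h (ini v) = ini' v) ->
  (forall v v' x a, h (f v v' x a) = f' v v' (h x) (h a)) ->
  h (table z ini f n k u) = table z' ini' f' n k u.
Proof.
move=> hz hi hf; elim: k u => //= k IH u; rewrite -hi.
by elim: (iota 0 n) (ini u) => //= v l IHl a; rewrite IHl hf IH.
Qed.

(** In the shifted encoding [0] stands for infinity, so each upper bound on the result comes with
    its positivity. *)
Lemma foldl_relax_min (b : pred nat) (c x : nat -> nat) a l :
  let m := foldl (fun a v => relax_min (b v) (c v) (x v) a) a l in
  [/\ m = a \/ exists v, [/\ v \in l, b v, (0 < x v)%N & m = (x v + c v)%N],
      (0 < a)%N -> (0 < m <= a)%N &
      forall v, v \in l -> b v -> (0 < x v)%N -> (0 < m <= x v + c v)%N].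
Proof.
elim/last_ind: l => [|l v [IH1 IH2 IH3]] /=; first by split=> //; [left | move=> ->; rewrite leqnn].
rewrite foldl_rcons; set m := foldl _ _ _ in IH1 IH2 IH3 *; rewrite /relax_min.
case: ifP => [/and3P[bv xv Hm]|Hm].
  split.
  - by right; exists v; rewrite mem_rcons mem_head.
  - by move=> /IH2 /andP[m0 lem]; case/orP: Hm => [/eqP|] Hm; lia.
  - move=> v'; rewrite mem_rcons inE => /predU1P[->|vl] bv' xv'; first by lia.
    by have := IH3 _ vl bv' xv'; case/orP: Hm => [/eqP|] Hm; lia.
split=> //.
- case: IH1 => [->|[v' [vl bv xv ->]]]; [by left | right; exists v'].
  by rewrite mem_rcons inE vl orbT.
- move=> v'; rewrite mem_rcons inE => /predU1P[->|vl] bv' xv'; last exact: IH3.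
  by move: Hm; rewrite bv' xv' /=; case: eqP => //=; lia.
Qed.

Lemma foldl_relax_max (b : pred nat) (c x : nat -> nat) a l :
  let m := foldl (fun a v => relax_max (b v) (c v) (x v) a) a l in
  [/\ m = a \/ exists v, [/\ v \in l, b v, (0 < x v)%N & m = (x v + c v)%N],
      (a <= m)%N &
      forall v, v \in l -> b v -> (0 < x v)%N -> (x v + c v <= m)%N].
Proof.
elim/last_ind: l => [|l v [IH1 IH2 IH3]] /=; first by split=> //; left.
rewrite foldl_rcons; set m := foldl _ _ _ in IH1 IH2 IH3 *; rewrite /relax_max.
have IH1' : m = a \/ exists v', [/\ v' \in rcons l v, b v', (0 < x v')%N & m = (x v' + c v')%N].
  case: IH1 => [->|[v' [vl bv xv ->]]]; [by left | right; exists v'].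
  by rewrite mem_rcons inE vl orbT.
case: ifP => [/andP[bv xv]|Hm].
  split; last 1 first.
  - move=> v'; rewrite mem_rcons inE => /predU1P[->|vl] bv' xv'; first exact: leq_maxr.
    by rewrite leq_max IH3.
  - rewrite /maxn; case: ifP => // _; right; exists v.
    by rewrite mem_rcons mem_head.
  - by rewrite leq_max IH2.
split=> // v'; rewrite mem_rcons inE => /predU1P[->|vl] bv' xv'; last exact: IH3.
by move: Hm; rewrite bv' xv'.
Qed.

Lemma relax_prob1 (R : realFieldType) (q : R) c x a :
  (relax_prob q c x a).1 = relax_min (0 < q) c x.1 a.1.
Proof.
rewrite /relax_prob /relax_min; case: (0 < q) => //=; case: (0 < x.1)%N => //=.
by case: ifP => // _; case: ifP.
Qed.

(** Filtering by the final minimum agrees with the fold: at a strict improvement every earlier term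
    exceeds the new minimum and drops out of the sum. *)
Lemma foldl_relax_prob (R : realFieldType) (q : nat -> R) (c : nat -> nat)
    (x : nat -> nat * R) l :
  let m := foldl (fun a v => relax_prob (q v) (c v) (x v) a) (0%N, 0) l in
  m.1 = foldl (fun a v => relax_min (0 < q v) (c v) (x v).1 a) 0%N l /\
  m.2 = \sum_(v <- l | [&& 0 < q v, (0 < (x v).1)%N & ((x v).1 + c v)%N == m.1])
           q v * (x v).2.
Proof.
elim/last_ind: l => [|l v [IH1 IH2]] /=; first by rewrite big_nil.
rewrite !foldl_rcons; set m := foldl _ (0%N, 0) _ in IH1 IH2 *.
have E1 := relax_prob1 (q v) (c v) (x v) m.
split; first by rewrite E1 IH1.
have [_ _] := foldl_relax_min (fun v => 0 < q v) c (fun v => (x v).1) 0 l.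
rewrite /= -IH1 => lb.
rewrite E1 -cats1 big_cat /= [X in _ = _ + X]big_mkcond big_seq1 /relax_prob /relax_min.
case: ifP => [/andP[q0 x0]|nqx]; last first.
  by rewrite !andbA !nqx /= addr0.
rewrite q0 x0 /=; case: ifP => [Hm|/norP[m0 Hm]].
  rewrite eqxx big_seq_cond big1 ?add0r 1?mulrC // => v' /and4P[vl q' x' /eqP e'].
  by have := lb _ vl q' x'; rewrite /= e'; case/orP: Hm => [/eqP|] Hm; lia.
by case: ifP => Heq; rewrite /= -IH2 ?addr0 // mulrC.
Qed.

(** * Table entries as path costs, for [E] and for the arcs of positive probability alike *)

Section Paths.
Variables (n : nat) (w : 'I_n -> 'I_n -> nat) (t : 'I_n) (e : rel 'I_n).
Variables (b : nat -> nat -> bool) (c : nat -> nat -> nat).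
Hypothesis b_e : forall u v : 'I_n, b u v = e u v.
Hypothesis c_w : forall u v : 'I_n, e u v -> c u v = w u v.

Lemma stpath_cons u v q : stpath e t u (v :: q) = e u v && stpath e t v q.
Proof. by rewrite /stpath /= andbA. Qed.

Let mint := table 0%N (ind t) (fun u v => relax_min (b u v) (c u v)) n.

(** Attainment; together with [min_table_le] it makes a positive entry the minimum once all paths
    have fewer than [k] arcs. *)
Lemma min_table_path k (u : 'I_n) : (0 < mint k u)%N ->
  exists2 q, stpath e t u q & mint k u = (wcost w u q).+1.
Proof.
elim: k u => // k IH u.
have := foldl_relax_min (b u) (c u) (mint k) (ind t u) (iota 0 n).
rewrite -[foldl _ _ _]/(mint k.+1 u) => -[H _ _]; case: H => [->|[v [vn bv xv ->]]] => [|_].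
  by rewrite /ind; case: eqP => // /val_inj -> _; exists [::] => //; rewrite /stpath /=.
rewrite mem_iota add0n /= in vn; pose v' := Ordinal vn.
have {}bv : e u v' by rewrite -b_e.
have [q sq eq] := IH v' xv; exists (v' :: q); first by rewrite stpath_cons bv.
by rewrite /= -c_w // [mint k v]eq /=; lia.
Qed.

Lemma min_table_le k (u : 'I_n) q : stpath e t u q -> (size q < k)%N ->
  (0 < mint k u <= (wcost w u q).+1)%N.
Proof.
elim: k u q => // k IH u q sq ltq.
have := foldl_relax_min (b u) (c u) (mint k) (ind t u) (iota 0 n).
rewrite -[foldl _ _ _]/(mint k.+1 u) => -[_ H2 H3].
case: q sq ltq => [|v q].
  by rewrite /stpath /= => /eqP eut _; move: H2; rewrite /ind eut eqxx => /(_ isT).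
rewrite stpath_cons /= => /andP[euv sq] ltq.
have /andP[x0 xle] := IH v q sq ltq.
have := H3 v; rewrite mem_iota add0n ltn_ord b_e c_w // => /(_ isT euv x0).
by case/andP=> -> /= /leq_trans; apply; lia.
Qed.

Let maxt := table 0%N (ind t) (fun u v => relax_max (b u v) (c u v)) n.

Lemma max_table_path k (u : 'I_n) : (0 < maxt k u)%N ->
  exists2 q, stpath e t u q & maxt k u = (wcost w u q).+1.
Proof.
elim: k u => // k IH u.
have := foldl_relax_max (b u) (c u) (maxt k) (ind t u) (iota 0 n).
rewrite -[foldl _ _ _]/(maxt k.+1 u) => -[H _ _]; case: H => [->|[v [vn bv xv ->]]] => [|_].
  by rewrite /ind; case: eqP => // /val_inj -> _; exists [::] => //; rewrite /stpath /=.
rewrite mem_iota add0n /= in vn; pose v' := Ordinal vn.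
have {}bv : e u v' by rewrite -b_e.
have [q sq eq] := IH v' xv; exists (v' :: q); first by rewrite stpath_cons bv.
by rewrite /= -c_w // [maxt k v]eq /=; lia.
Qed.

Lemma max_table_ge k (u : 'I_n) q : stpath e t u q -> (size q < k)%N ->
  ((wcost w u q).+1 <= maxt k u)%N.
Proof.
elim: k u q => // k IH u q sq ltq.
have := foldl_relax_max (b u) (c u) (maxt k) (ind t u) (iota 0 n).
rewrite -[foldl _ _ _]/(maxt k.+1 u) => -[_ H2 H3].
case: q sq ltq => [|v q].
  by rewrite /stpath /= => /eqP eut _; apply: leq_trans H2; rewrite /ind eut eqxx.
rewrite stpath_cons /= => /andP[euv sq] ltq.
have xle := IH v q sq ltq.
have := H3 v; rewrite mem_iota add0n ltn_ord b_e c_w // => /(_ isT euv (leq_trans _ xle)).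
by move=> /(_ isT); lia.
Qed.

End Paths.

(** * The probability of the cheapest cost *)

Section Prob.
Variables (R : realFieldType) (n : nat) (E : rel 'I_n) (w : 'I_n -> 'I_n -> nat).
Variables (t : 'I_n) (p : 'I_n -> 'I_n -> R) (nm0 : nat -> nat) (rm0 : nat -> R).
Hypothesis p_ge0 : forall u v, 0 <= p u v.
Hypothesis suppE : forall u v, supp p u v -> E u v.
Hypothesis supp_t : forall v, ~~ supp p t v.
Hypothesis pr_p : forall u v : 'I_n, pr n rm0 u v = p u v.
Hypothesis wt_w : forall u v : 'I_n, E u v -> wt n nm0 u v = w u v.

Let probt := prob_tab n t nm0 rm0.

Lemma prob_tab1 k u : (probt k u).1 =
  table 0%N (ind t) (fun u v => relax_min (0 < pr n rm0 u v) (wt n nm0 u v)) n k u.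
Proof. by apply: (table_morph (h := fst)) => // v v' x a; apply: relax_prob1. Qed.

Lemma prob_tab1_le k u q : stpath (supp p) t u q -> (size q < k)%N ->
  (0 < (probt k u).1 <= (wcost w u q).+1)%N.
Proof.
rewrite prob_tab1; apply: min_table_le => [u' v'|u' v' s']; first by rewrite pr_p.
by rewrite wt_w ?suppE.
Qed.

(** If the best continuation from [v] attains the minimum at [u], the indicator at [u], shifted by
    the weight of [uv], is the indicator at [v]. Otherwise it vanishes on all positive paths through
    [uv]. *)
Lemma prob_tab2 k (u : 'I_n) :
  (probt k u).2 = expect E w t p k u (fun c => (c.+1 == (probt k u).1)%:R).
Proof.
elim: k u => [|k IH] u; first by rewrite expect0.
rewrite expectS; have [->|ut] := eqVneq u t.
  (* No arc of positive probability leaves [t], so the fold keeps the initial pair. *)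
  suff -> : probt k.+1 t = (1%N, 1) by [].
  rewrite /probt /prob_tab /= /ind eqxx.
  have : forall v, v \in iota 0 n -> ~~ (0 < pr n rm0 t v).
    by move=> v; rewrite mem_iota add0n /= => vn; rewrite (pr_p t (Ordinal vn)); apply: supp_t.
  elim: (iota 0 n) => //= v l IHl H.
  rewrite [X in foldl _ X]/prob_step /relax_prob (negbTE (H v _)) ?mem_head //= IHl // => v' v'l.
  by apply: H; rewrite inE v'l orbT.
have Eu : ind t u = 0%N by rewrite /ind; case: eqP => // /val_inj /eqP; rewrite (negbTE ut).
have := foldl_relax_prob (pr n rm0 u) (wt n nm0 u) (probt k) (iota 0 n).
have -> : foldl (fun a v => relax_prob (pr n rm0 u v) (wt n nm0 u v) (probt k v) a) (0%N, 0) (iota 0 n)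
          = probt k.+1 u by rewrite /probt /prob_tab /= Eu.
set m := probt k.+1 u => -[m1 ->].
have [_ _ lb] := foldl_relax_min (fun v => 0 < pr n rm0 u v) (wt n nm0 u) (fun v => (probt k v).1) 0 (iota 0 n).
rewrite -m1 in lb.
rewrite -[n in iota 0 n]subn0 -/(index_iota 0 n) big_mkord big_mkcond [RHS]big_mkcond /=.
apply: eq_bigr => v _; rewrite pr_p.
have [pz|pnz] := eqVneq (p u v) 0; first by rewrite pz !mul0r !if_same.
have suv : supp p u v by rewrite /supp lt0r pnz p_ge0.
rewrite (suppE suv) wt_w ?suppE // [0 < p u v]suv /=.
(* A zero entry at [v] excludes every path of fewer than [k] positive arcs, so the indicator may be
   replaced by 0. *)
have [x0|x0] := posnP (probt k v).1.
  rewrite -(mulr0 (p u v)); congr (_ * _); rewrite -(expect_const0 E w t p k v).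
  by apply: eq_expect => // q sq ltq; have := prob_tab1_le sq ltq; rewrite x0.
have := lb v; rewrite mem_iota add0n ltn_ord pr_p wt_w ?suppE // => /(_ isT suv x0) /andP[m0 lem].
case: eqP => [em|nem] /=.
  congr (_ * _); rewrite IH; apply: eq_expect => // q _ _; congr (_%:R); congr nat_of_bool.
  by apply/eqP/eqP; move: em; move: (probt k v).1 m.1 => a d; lia.
rewrite -(mulr0 (p u v)); congr (_ * _); rewrite -(expect_const0 E w t p k v).
apply: eq_expect => // q sq ltq; have := prob_tab1_le sq ltq => /andP[_ leq].
by case: eqP => // eqm; move: eqm nem lem leq; move: (probt k v).1 m.1 => a d; lia.
Qed.

End Prob.

(** * The input encoding and the correctness of both answers *)

Lemma enc2E (T : Type) n (x : T) (f : 'I_n -> 'I_n -> T) (u v : 'I_n) :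
  enc2 x f (u * n + v) = f u v.
Proof.
have n0 : (0 < n)%N by apply: leq_ltn_trans (ltn_ord u).
by rewrite /enc2 divnMDl // modnMDl divn_small // modn_small // addn0 !valK.
Qed.

Lemma enc2_out (T : Type) n (x : T) (f : 'I_n -> 'I_n -> T) i :
  (n * n <= i)%N -> enc2 x f i = x.
Proof.
move=> lei; rewrite /enc2; case: insubP => // u lt_i _.
case: n f lei u lt_i => [|n] f lei u lt_i; first by case: u.
by move: lt_i; rewrite ltnNge leq_divRL // lei.
Qed.

Section Correctness.
Variables (R : realFieldType) (n : nat) (E : rel 'I_n) (w : 'I_n -> 'I_n -> nat).
Variables (s t : 'I_n) (p : 'I_n -> 'I_n -> R) (beta : R) (d : nat).
Let st0 := init_state E w s t p beta.
Let nm0 := nmem st0.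
Let rm0 := rmem st0.
Let distt := dist_tab n t nm0 n s.
Let maxt := max_tab n t nm0 rm0 n s.
Let probt := prob_tab n t nm0 rm0 n s.

Lemma program_final b :
  let P := compile 0 (program b) in let fin := exec P (100 * n ^ 3 + 100) st0 in
  [/\ halted P fin,
      rreg fin 0 = ((if b then maxt else probt.1) - 1)%:R / (distt - 1)%:R &
      rreg fin 1 = probt.2].
Proof.
have H : wp (program b) (program_time n) (final_inv n s t nm0 rm0 b) st0.
  apply: programP => //.
  - move=> i lei; rewrite /nm0 /=; case: ifP => lti; first by lia.
    by rewrite enc2_out //; lia.
  - move=> i lei; rewrite /rm0 /=; case: ifP => lti; first by lia.
    (* [beta] sits at address [n^2], which is below [2 n^2] since the vertex [s] makes [n]
       positive. *)
    by case: eqP => // ei; have := ltn_ord s; nia.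
  - by split=> // -[|[|[|i]]].
move=> P fin; have [h [st' [r0 r1] ef]] := wp_exec (program_time_le n) H.
have {}ef : fin = goto (csize (program b)) st' by exact: ef.
by split; [exact: h | rewrite ef | rewrite ef].
Qed.

Hypotheses (valid : valid_model E w s t p beta) (dist_d : is_dist E w s t d) (d_gt0 : (0 < d)%N).

Lemma valid_acyclic : acyclic E. Proof. by case: valid => -[]. Qed.
Lemma valid_ge0 u v : 0 <= p u v. Proof. by case: valid => -[]. Qed.
Lemma valid_connect : connect E s t. Proof. by case: valid => -[]. Qed.
Lemma valid_sum u : u != t -> connect E u t -> \sum_(v | E u v) p u v = 1.
Proof. by case: valid => _ [] /(_ u). Qed.

Lemma supp_arc u v : supp p u v -> E u v.
Proof. by case: valid => _ [_ H] /H[]. Qed.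

Lemma supp_connect u v : supp p u v -> connect E v t.
Proof.
case: valid => _ [_ H] /H[_ [q [sq _]]]; apply/connectP; exists q.
  by case/andP: sq => /= /andP[].
by case/andP: sq => /= _ /eqP.
Qed.

(** Such an arc would start a perceived path from [t] back to [t], closing a cycle. *)
Lemma supp_target v : ~~ supp p t v.
Proof.
apply/negP => stv; have := valid_acyclic (supp_arc stv).
by rewrite (supp_connect stv).
Qed.

Lemma supp_stpath u q : stpath (supp p) t u q -> stpath E t u q.
Proof.
by case/andP=> pq lq; rewrite /stpath lq andbT; apply: sub_path pq => x y; apply: supp_arc.
Qed.

Lemma stpath_size u q : stpath E t u q -> (size q < n)%N.
Proof. by case/andP=> pq _; apply: acyclic_size valid_acyclic pq. Qed.

Lemma supp_size u q : stpath (supp p) t u q -> (size q < n)%N.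
Proof. by move/supp_stpath/stpath_size. Qed.

Lemma arc_init (u v : 'I_n) : has_arc n nm0 u v = E u v.
Proof. by rewrite /has_arc /nm0 /= index_lt // enc2E lt0b. Qed.

Lemma wt_init (u v : 'I_n) : E u v -> wt n nm0 u v = w u v.
Proof. by move=> Euv; rewrite /wt /nm0 /= ltnNge leq_addr /= addKn enc2E Euv. Qed.

(** Off the arcs the memory holds 0, and there [p] is 0 too, being nonnegative and positive only on
    arcs. *)
Lemma pr_init (u v : 'I_n) : pr n rm0 u v = p u v.
Proof.
rewrite /pr /rm0 /= index_lt // enc2E; case: ifPn => // nE.
by apply/eqP; rewrite eq_sym eq_le valid_ge0 andbT leNgt; apply: contra nE; apply: supp_arc.
Qed.

Lemma dist_tabE : distt = d.+1.
Proof.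
case: dist_d => -[q [sq <-]] min_d.
have /andP[x0 le1] := min_table_le arc_init wt_init sq (stpath_size sq).
have [q' sq' eq'] := min_table_path arc_init wt_init x0.
apply/eqP; rewrite eqn_leq le1 /= /distt /dist_tab.
by move: eq'; rewrite /dist_step => ->; rewrite ltnS min_d.
Qed.

Let g (W : R) (c : nat) : R := if c%:R / d%:R <= W then 1 else 0.

Lemma PrLeE W : PrLe E w s t p d W = expect E w t p n s (g W).
Proof. by []. Qed.

Lemma g_ge0 W c : 0 <= g W c. Proof. by rewrite /g; case: ifP. Qed.

Lemma g_gt0 W c : (0 < g W c) = (c%:R / d%:R <= W).
Proof. by rewrite /g; case: ifP; rewrite ?ltr01 ?ltxx. Qed.

Lemma le_ratio (a b : nat) : (a%:R / d%:R <= b%:R / d%:R :> R) = (a <= b)%N.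
Proof. by rewrite ler_pM2r ?invr_gt0 ?ltr0n // ler_nat. Qed.

Lemma expect1 : expect E w t p n s (fun=> 1) = 1.
Proof.
apply: expect_total => //; [exact: valid_ge0 | exact: valid_sum | exact: supp_connect
  | exact: valid_connect | exact: stpath_size].
Qed.

(** The total mass is 1, and positive mass needs a path to carry it. *)
Lemma supp_path_exists : exists q, stpath (supp p) t s q.
Proof.
have [||q [sq _ _]] := @expect_gt0P _ _ E w t p valid_ge0 n s (fun=> 1) _ _.
- by move=> _; apply: ler01.
- by rewrite expect1 ltr01.
- by exists q.
Qed.

Lemma supp_init (u v : 'I_n) : (0 < pr n rm0 u v) = supp p u v.
Proof. by rewrite pr_init. Qed.

Lemma supp_wt (u v : 'I_n) : supp p u v -> wt n nm0 u v = w u v.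
Proof. by move=> /supp_arc; apply: wt_init. Qed.

Lemma min_cost_path : exists q, stpath (supp p) t s q /\ probt.1 = (wcost w s q).+1.
Proof.
have [q sq] := supp_path_exists.
have /andP[x0 _] := prob_tab1_le supp_arc pr_init wt_init sq (supp_size sq).
move: x0; rewrite /probt prob_tab1 => x0.
have [q' sq' e'] := min_table_path (b := fun u v => 0 < pr n rm0 u v) supp_init supp_wt x0.
by exists q'.
Qed.

Lemma max_tab_ge q : stpath (supp p) t s q -> (wcost w s q < maxt)%N.
Proof.
move=> sq.
exact: (max_table_ge (b := fun u v => 0 < pr n rm0 u v) supp_init supp_wt sq (supp_size sq)).
Qed.

Lemma max_cost_path : exists q, stpath (supp p) t s q /\ maxt = (wcost w s q).+1.
Proof.
have [q /max_tab_ge x0] := supp_path_exists.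
have [|q' sq' e'] := @max_table_path _ w t _ (fun u v => 0 < pr n rm0 u v) _
  supp_init supp_wt n s; last by exists q'.
exact: leq_ltn_trans x0.
Qed.

Lemma min_cost_correct :
  let W := (probt.1 - 1)%:R / (distt - 1)%:R in
  [/\ 0 < PrLe E w s t p d W, forall W', 0 < PrLe E w s t p d W' -> W <= W' &
      probt.2 = PrLe E w s t p d W].
Proof.
rewrite dist_tabE; have [q [sq eq]] := min_cost_path; rewrite eq !subn1 /=.
have lb q' : stpath (supp p) t s q' -> (wcost w s q <= wcost w s q')%N.
  move=> sq'; have := prob_tab1_le supp_arc pr_init wt_init sq' (supp_size sq').
  by rewrite -/probt eq.
split.
- rewrite PrLeE; apply: (expect_gt0 valid_ge0 supp_arc supp_target (g_ge0 _) sq).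
    exact: supp_size sq.
  by rewrite g_gt0.
- move=> W'; rewrite PrLeE => /(expect_gt0P valid_ge0 (g_ge0 W'))[q' [sq' _]].
  by rewrite g_gt0; apply: le_trans; rewrite le_ratio lb.
- rewrite PrLeE /probt (prob_tab2 valid_ge0 supp_arc supp_target pr_init wt_init).
  apply: eq_expect; first exact: valid_ge0.
  (* On these paths no cost is below the minimum, so being at most the minimum means being equal to
     it. *)
  move=> q' sq' _; rewrite -/probt eq /g le_ratio eqSS eqn_leq lb // andbT.
  by case: leq.
Qed.

Lemma max_cost_correct :
  let W := (maxt - 1)%:R / (distt - 1)%:R in
  PrLe E w s t p d W = 1 /\ forall W', PrLe E w s t p d W' = 1 -> W <= W'.
Proof.
rewrite dist_tabE; have [q [sq eq]] := max_cost_path.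
have ub q' : stpath (supp p) t s q' -> (wcost w s q' <= wcost w s q)%N.
  by move/max_tab_ge; rewrite eq.
rewrite eq !subn1 /=; split.
  rewrite PrLeE -[RHS]expect1; apply: eq_expect; first exact: valid_ge0.
  by move=> q' sq' _; rewrite /g le_ratio ub.
move=> W'; rewrite PrLeE leNgt => H; apply/negP => ltW.
(* For [W'] below the dearest ratio, exceeding [W'] has positive probability, since the dearest path
   does so. *)
suff : 0 < expect E w t p n s (fun c => 1 - g W' c) by rewrite expectB expect1 H subrr ltxx.
apply: (expect_gt0 valid_ge0 supp_arc supp_target _ sq).
- by move=> c; rewrite /g; case: ifP; rewrite ?subrr ?subr0.
- exact: supp_size sq.
- by rewrite /g leNgt ltW subr0 ltr01.
Qed.

End Correctness.

Theorem theorem3 (R : realType) :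
  (* (i) Minimum Cost of Irrationality in time O(n^3) *)
  (exists (P : seq instr) (c : nat),
    forall (n : nat) (E : rel 'I_n) (w : 'I_n -> 'I_n -> nat) (s t : 'I_n)
           (p : 'I_n -> 'I_n -> R) (beta : R) (d : nat),
      valid_model E w s t p beta -> is_dist E w s t d -> (0 < d)%N ->
      let fin := exec P (c * n ^ 3 + c) (init_state E w s t p beta) in
      [/\ halted P fin,
          0 < PrLe E w s t p d (rreg fin 0%N),
          (forall W : R, 0 < PrLe E w s t p d W -> rreg fin 0%N <= W) &
          rreg fin 1%N = PrLe E w s t p d (rreg fin 0%N)]) /\
  (* (ii) Maximum Cost of Irrationality in time O(n^3) *)
  (exists (P : seq instr) (c : nat),
    forall (n : nat) (E : rel 'I_n) (w : 'I_n -> 'I_n -> nat) (s t : 'I_n)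
           (p : 'I_n -> 'I_n -> R) (beta : R) (d : nat),
      valid_model E w s t p beta -> is_dist E w s t d -> (0 < d)%N ->
      let fin := exec P (c * n ^ 3 + c) (init_state E w s t p beta) in
      [/\ halted P fin,
          PrLe E w s t p d (rreg fin 0%N) = 1 &
          (forall W : R, PrLe E w s t p d W = 1 -> rreg fin 0%N <= W)]).
Proof.
split; [exists (compile 0 (program false)) | exists (compile 0 (program true))].
  exists 100%N => n E w s t p beta d valid dist_d d_gt0 fin.
  have [h r0 r1] := program_final E w s t p beta false.
  have [H1 H2 H3] := min_cost_correct valid dist_d d_gt0.
  by split=> //; rewrite r0 // r1.
exists 100%N => n E w s t p beta d valid dist_d d_gt0 fin.
have [h r0 _] := program_final E w s t p beta true.
have [H1 H2] := max_cost_correct valid dist_d d_gt0.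
by split=> //; rewrite r0.
Qed.
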